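(* Let $0<q<1$, $k>0$, $s,t>-1$, $x,y\in\mathbb{Z}_{\ge0}$, and $v\in\mathbb{C}$ with $\mathrm{Re}(v)<1+s+t$. Then $P_{\mathrm r}(x,y)=P_{\mathrm r}(x,y;s,t,v,k;q)$ satisfies $$\{2x+k+s\}_q\Big(c_{-1}(y,t)P_{\mathrm r}(x,y-1)+c_0(y,t)P_{\mathrm r}(x,y)+c_1(y,t)P_{\mathrm r}(x,y+1)\Big)$$ $$=d_{-1}(y,t)P_{\mathrm r}(x,y-1)+\big(d_0(y,t)+\{s\}_q\big)P_{\mathrm r}(x,y)+d_1(y,t)P_{\mathrm r}(x,y+1),$$ where for $y=0$ the terms involving $P_{\mathrm r}(x,-1)$ are omitted.
   Context: $q^z=e^{z\log q}$; $\{z\}_q=\frac{q^z+q^{-z}}{q+q^{-1}}$; $(\alpha;p)_n=\prod_{i=0}^{n-1}(1-\alpha p^i)$, $(\alpha_1,\dots,\alpha_m;p)_n=\prod_i(\alpha_i;p)_n$. For $n,x\in\mathbb{Z}_{\ge0}$, $$\phi_{u,s}(n,x)=q^{n(s-u+\frac12k+\frac12)}\sum_{j=0}^{\min(n,x)}\frac{(q^{2n},\,q^{2x},\,q^{-2x-2s-2k};q^{-2})_j}{(q^{-2k},\,q^{-2};q^{-2})_j}q^{-2j},\qquad w_k(n)=q^{-n(k-1)}\frac{(q^{2k};q^2)_n}{(q^2;q^2)_n},$$ and $P_{\mathrm r}(x,y;s,t,v,k;q)=\sum_{n=0}^\infty\phi_{1,s}(n,x)\,\phi_{v,t}(n,y)\,w_k(n)$,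 absolutely convergent for $\mathrm{Re}(v)<1+s+t$. Coefficients: $$c_{-1}(y,t)=\frac{q^{-4y-2t-3k+2}(1-q^{-2y})(1-q^{-2y-2t})}{(1-q^{-4y-2t-2k+2})(1-q^{-4y-2t-2k})},\qquad c_1(y,t)=\frac{q^k(1-q^{-2y-2k})(1-q^{-2y-2t-2k})}{(1-q^{-4y-2t-2k})(1-q^{-4y-2t-2k-2})},$$ $$c_0(y,t)=q^k-c_{-1}(y,t)-c_1(y,t),$$ $$d_{-1}(y,t)=c_{-1}(y,t)\{2y+t+k+v-1\}_q,\quad d_0(y,t)=c_0(y,t)\{2y+k+t\}_q\{v\}_q-\{t\}_q\{v\}_q,\quad d_1(y,t)=c_1(y,t)\{2y+k+t-v+1\}_q.$$ For $y=0$: $c_{-1}(0,t)=0$, and the common factor $1-q^{-2t-2k}$ in $c_1(0,t)$ is cancelled. *)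

(* Defs.v *)
(* Stdlib real numbers; Coquelicot for series and complex numbers. *)
From Stdlib Require Import Reals Lra Lia.
From Coquelicot Require Import Coquelicot.

Local Open Scope R_scope.

Definition Cexp (z : C) : C := (exp (Re z) * cos (Im z), exp (Re z) * sin (Im z)).

(* q^z = e^(z log q).  For real exponents, [Rpower q z] = exp (z * ln q) is used. *)
Definition Cqpow (q : R) (z : C) : C := Cexp (z * RtoC (ln q))%C.

(* {z}_q *)
Definition qbrace (q : R) (z : C) : C :=
  ((Cqpow q z + Cqpow q (- z)) / RtoC (q + / q))%C.

(* (a; p)_n *)
Fixpoint qpoch (a p : R) (n : nat) : R :=
  match n with
  | O => 1
  | S m => qpoch a p m * (1 - a * p ^ m)
  end.

(* Only the prefactor of phi involves the complex parameter u: the terms of the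
   terminating sum are real. *)
Definition phi_term (s k q : R) (n x j : nat) : R :=
  let p := Rpower q (-2) in
  qpoch (Rpower q (2 * INR n)) p j
  * qpoch (Rpower q (2 * INR x)) p j
  * qpoch (Rpower q (- 2 * INR x - 2 * s - 2 * k)) p j
  / (qpoch (Rpower q (- 2 * k)) p j * qpoch p p j)
  * Rpower q (- 2 * INR j).

Definition phi (u : C) (s k q : R) (n x : nat) : C :=
  (Cqpow q (RtoC (INR n) * (RtoC s - u + RtoC (k / 2) + RtoC (1 / 2)))
   * RtoC (sum_f_R0 (phi_term s k q n x) (Nat.min n x)))%C.

Definition w (k q : R) (n : nat) : R :=
  Rpower q (- INR n * (k - 1))
  * qpoch (Rpower q (2 * k)) (q ^ 2) n / qpoch (q ^ 2) (q ^ 2) n.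

Definition Pr_term (x y : nat) (s t : R) (v : C) (k q : R) (n : nat) : C :=
  (phi (RtoC 1) s k q n x * phi v t k q n y * RtoC (w k q n))%C.

(* Meaningful only when both real series converge, see [Pr_abs_convergent]. *)
Definition CSeries (a : nat -> C) : C :=
  (Series (fun n => Re (a n)), Series (fun n => Im (a n))).

Definition Pr (x y : nat) (s t : R) (v : C) (k q : R) : C :=
  CSeries (Pr_term x y s t v k q).

(* [f (y - 1)], omitted (zero) at y = 0; plain [f (y - 1)] would be [f 0] there. *)
Definition at_pred (f : nat -> C) (y : nat) : C :=
  match y with
  | O => RtoC 0
  | S y' => f y'
  end.

(* At y = 0 the generic formula has denominator 1 - q^(-2t-2k+2), which may vanish. *)
Definition c_m1 (y : nat) (t k q : R) : R :=
  match y with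
  | O => 0
  | S _ =>
      let Y := INR y in
      Rpower q (- 4 * Y - 2 * t - 3 * k + 2)
      * (1 - Rpower q (- 2 * Y)) * (1 - Rpower q (- 2 * Y - 2 * t))
      / ((1 - Rpower q (- 4 * Y - 2 * t - 2 * k + 2))
         * (1 - Rpower q (- 4 * Y - 2 * t - 2 * k)))
  end.

(* At y = 0 the factor 1 - q^(-2t-2k), which vanishes for t = -k, is cancelled. *)
Definition c_1 (y : nat) (t k q : R) : R :=
  match y with
  | O => Rpower q k * (1 - Rpower q (- 2 * k)) / (1 - Rpower q (- 2 * t - 2 * k - 2))
  | S _ =>
      let Y := INR y in
      Rpower q k
      * (1 - Rpower q (- 2 * Y - 2 * k)) * (1 - Rpower q (- 2 * Y - 2 * t - 2 * k))
      / ((1 - Rpower q (- 4 * Y - 2 * t - 2 * k))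
         * (1 - Rpower q (- 4 * Y - 2 * t - 2 * k - 2)))
  end.

Definition c_0 (y : nat) (t k q : R) : R :=
  Rpower q k - c_m1 y t k q - c_1 y t k q.

Definition d_m1 (y : nat) (t : R) (v : C) (k q : R) : C :=
  (RtoC (c_m1 y t k q) * qbrace q (RtoC (2 * INR y + t + k) + v - RtoC 1))%C.

Definition d_0 (y : nat) (t : R) (v : C) (k q : R) : C :=
  (RtoC (c_0 y t k q) * qbrace q (RtoC (2 * INR y + k + t)) * qbrace q v
   - qbrace q (RtoC t) * qbrace q v)%C.

Definition d_1 (y : nat) (t : R) (v : C) (k q : R) : C :=
  (RtoC (c_1 y t k q) * qbrace q (RtoC (2 * INR y + k + t) - v + RtoC 1))%C.

Lemma Cmod_Cexp (z : C) : Cmod (Cexp z) = exp (Re z).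
Proof.
  unfold Cmod, Cexp; simpl fst; simpl snd.
  replace (_ + _) with (exp (Re z) ^ 2)
    by (generalize (sin2_cos2 (Im z)); unfold Rsqr; intros H;
        transitivity (exp (Re z) ^ 2 * (sin (Im z) * sin (Im z) + cos (Im z) * cos (Im z)));
        [ rewrite H | ]; ring).
  apply sqrt_pow2, Rlt_le, exp_pos.
Qed.

Lemma Rpower_lt_1 (q a : R) : 0 < q < 1 -> 0 < a -> Rpower q a < 1.
Proof.
  intros [H0 H1] Ha; unfold Rpower; rewrite <- exp_0; apply exp_increasing.
  assert (ln q < 0) by (rewrite <- ln_1; apply ln_increasing; lra). nra.
Qed.

Lemma Rpower_le_1 (q a : R) : 0 < q < 1 -> 0 <= a -> Rpower q a <= 1.
Proof.
  intros Hq [Ha | <-].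
  - left; now apply Rpower_lt_1.
  - rewrite Rpower_O; lra.
Qed.

Lemma qpoch_bounds (a p : R) (n : nat) :
  (forall i, (i < n)%nat -> 0 <= 1 - a * p ^ i <= 1) -> 0 <= qpoch a p n <= 1.
Proof.
  induction n as [|n IH]; intros H; simpl; [lra|].
  assert (H1 := H n ltac:(lia)).
  assert (H2 : 0 <= qpoch a p n <= 1) by (apply IH; intros i Hi; apply H; lia).
  nra.
Qed.

Lemma qpoch_pos (a p : R) (n : nat) :
  (forall i, (i < n)%nat -> 0 < 1 - a * p ^ i) -> 0 < qpoch a p n.
Proof.
  induction n as [|n IH]; intros H; simpl; [lra|].
  apply Rmult_lt_0_compat; [|apply H; lia].
  apply IH; intros i Hi; apply H; lia.
Qed.

Lemma Rpower_pow_nat (q a : R) (n : nat) : Rpower q a ^ n = Rpower q (a * INR n).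
Proof. now rewrite <- Rpower_pow, Rpower_mult by apply exp_pos. Qed.

Lemma phi_sum_bounded (s k q : R) (x : nat) : 0 < q < 1 ->
  exists M, 0 <= M /\
    forall n, Rabs (sum_f_R0 (phi_term s k q n x) (Nat.min n x)) <= M.
Proof.
  intros Hq.
  set (g := fun j => Rabs (qpoch (Rpower q (2 * INR x)) (Rpower q (-2)) j
    * qpoch (Rpower q (- 2 * INR x - 2 * s - 2 * k)) (Rpower q (-2)) j
    / (qpoch (Rpower q (- 2 * k)) (Rpower q (-2)) j * qpoch (Rpower q (-2)) (Rpower q (-2)) j)
    * Rpower q (- 2 * INR j))).
  assert (Hg : forall j, 0 <= g j) by (intros j; apply Rabs_pos).
  exists (sum_f_R0 g x); split; [now apply cond_pos_sum|]; intros n.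
  apply Rle_trans with (sum_f_R0 g (Nat.min n x)).
  - eapply Rle_trans; [apply Rsum_abs|]. apply sum_Rle; intros j Hj.
    unfold phi_term, g.
    set (A := qpoch (Rpower q (2 * INR n)) _ j).
    assert (HA : 0 <= A <= 1).
    { apply qpoch_bounds; intros i Hi.
      rewrite Rpower_pow_nat, <- Rpower_plus.
      assert (INR i <= INR n) by (apply le_INR; lia).
      assert (Rpower q (2 * INR n + -2 * INR i) <= 1) by (apply Rpower_le_1; lra).
      assert (0 < Rpower q (2 * INR n + -2 * INR i)) by apply exp_pos. lra. }
    match goal with |- _ <= Rabs ?B => replace (Rabs _) with (Rabs (A * B)) at 1 end.
    2: { f_equal. unfold Rdiv. ring. }
    rewrite Rabs_mult, (Rabs_pos_eq A) by lra.
    rewrite <- (Rmult_1_l (Rabs _)) at 2.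
    apply Rmult_le_compat_r; [apply Rabs_pos | lra].
  - clearbody g. generalize (Nat.le_min_r n x). generalize (Nat.min n x); intros m Hm.
    induction Hm as [|x' Hm IH]; [lra|].
    rewrite tech5. specialize (Hg (S x')). lra.
Qed.

Lemma ex_series_geom_qpoch (e p : R) : 0 < e < 1 -> 0 < p < 1 ->
  ex_series (fun n => e ^ n / qpoch p p n).
Proof.
  intros He Hp.
  assert (Hf : forall i, 0 < 1 - p * p ^ i).
  { intros i. assert (0 < p ^ i) by (apply pow_lt; lra).
    assert (p ^ i <= 1) by (rewrite <- (pow1 i); apply pow_incr; lra). nra. }
  assert (Hpos : forall n, 0 < qpoch p p n) by (intros n; apply qpoch_pos; auto).
  apply ex_series_Rabs, ex_series_DAlembert with e; [lra| |].
  - intros n; apply Rgt_not_eq, Rdiv_lt_0_compat; [apply pow_lt; lra | apply Hpos].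
  - apply is_lim_seq_ext with (fun n => e * / (1 - p * p ^ n)).
    + intros n; rewrite Rabs_pos_eq.
      * simpl. field. assert (0 < e ^ n) by (apply pow_lt; lra).
        specialize (Hf n); specialize (Hpos n).
        change (qpoch p p (S n)) with (qpoch p p n * (1 - p * p ^ n)).
        repeat split; lra.
      * assert (forall m, 0 < e ^ m / qpoch p p m)
          by (intros m; apply Rdiv_lt_0_compat; [apply pow_lt; lra | apply Hpos]).
        apply Rlt_le, Rdiv_lt_0_compat; apply H.
    + replace (Finite e) with (Rbar_mult e (Rbar_inv (1 - p * 0)))
        by (simpl; f_equal; field; lra).
      apply is_lim_seq_scal_l, is_lim_seq_inv.
      * apply is_lim_seq_minus'; [apply is_lim_seq_const|].
        apply (is_lim_seq_scal_l _ p 0), is_lim_seq_geom. rewrite Rabs_pos_eq; lra.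
      * intros H; injection H; lra.
Qed.

Lemma Pr_abs_convergent (x y : nat) (s t : R) (v : C) (k q : R) :
  0 < q < 1 -> 0 < k -> Re v < 1 + s + t ->
  ex_series (fun n => Cmod (Pr_term x y s t v k q n)).
Proof.
  intros Hq Hk Hv.
  destruct (phi_sum_bounded s k q x Hq) as [M1 [HM1 H1]].
  destruct (phi_sum_bounded t k q y Hq) as [M2 [HM2 H2]].
  set (e := Rpower q (1 + s + t - Re v)).
  assert (He : 0 < e < 1) by (split; [apply exp_pos | apply Rpower_lt_1; lra]).
  assert (Hq2 : 0 < q ^ 2 < 1) by nra.
  apply (ex_series_le (K := R_AbsRing) (V := R_CompleteNormedModule))
    with (fun n => M1 * M2 * (e ^ n / qpoch (q ^ 2) (q ^ 2) n)).
  2: { apply (ex_series_scal (V := R_NormedModule) (M1 * M2)). now apply ex_series_geom_qpoch. }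
  intros n; unfold norm; simpl; unfold abs; simpl.
  rewrite Rabs_pos_eq by apply Cmod_ge_0.
  unfold Pr_term, phi, Cqpow.
  rewrite !Cmod_mult, !Cmod_Cexp, !Cmod_R.
  set (S1 := Rabs _). set (S2 := Rabs (sum_f_R0 (phi_term t _ _ _ _) _)).
  assert (HD : 0 < qpoch (q ^ 2) (q ^ 2) n).
  { apply qpoch_pos; intros i _. assert (0 < (q ^ 2) ^ i) by (apply pow_lt; lra).
    assert ((q ^ 2) ^ i <= 1) by (rewrite <- (pow1 i); apply pow_incr; lra). nra. }
  assert (HN : 0 <= qpoch (Rpower q (2 * k)) (q ^ 2) n <= 1).
  { apply qpoch_bounds; intros i _. assert (0 < (q ^ 2) ^ i) by (apply pow_lt; lra).
    assert ((q ^ 2) ^ i <= 1) by (rewrite <- (pow1 i); apply pow_incr; lra).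
    assert (0 < Rpower q (2 * k)) by apply exp_pos.
    assert (Rpower q (2 * k) < 1) by (apply Rpower_lt_1; lra). nra. }
  unfold w. rewrite Rabs_pos_eq.
  2: { apply Rmult_le_pos; [apply Rmult_le_pos; [apply Rlt_le, exp_pos | lra]|].
       apply Rlt_le, Rinv_0_lt_compat, HD. }
  match goal with |- exp ?a * _ * (exp ?b * _) * (Rpower q ?c * _ / _) <= _ =>
    assert (HE : exp a * exp b * Rpower q c = e ^ n) end.
  { unfold e; rewrite Rpower_pow_nat; unfold Rpower.
    rewrite <- !exp_plus; f_equal; destruct v as [v1 v2]; simpl. field. }
  match goal with |- exp ?a * _ * (exp ?b * _) * (Rpower q ?c * ?N / ?D) <= _ =>
    replace (exp a * S1 * (exp b * S2) * (Rpower q c * N / D))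
      with ((S1 * S2 * N) * (e ^ n / D)) by (rewrite <- HE; field; lra) end.
  apply Rmult_le_compat_r.
  { apply Rlt_le, Rdiv_lt_0_compat; [apply pow_lt; lra | apply HD]. }
  assert (0 <= S1 <= M1) by (split; [apply Rabs_pos | apply H1]).
  assert (0 <= S2 <= M2) by (split; [apply Rabs_pos | apply H2]).
  assert (0 <= S1 * S2) by nra.
  assert (S1 * S2 <= M1 * M2) by (apply Rmult_le_compat; lra).
  nra.
Qed.

(* Main.v *)
Require Import Defs.
From Stdlib Require Import Reals Lra Lia.
From Coquelicot Require Import Coquelicot.
Local Open Scope R_scope.

(** Write [h n = phi_(v,t)(n,y)], [f n = phi_(1,s)(n,x)], and let [K] be multiplication
    by q^(2n+k).  Both three-term recurrences of [phi] (in [n], with eigenvalue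
    {2y+k+t}; in [y], with eigenvalue q^(2n+k)) hold because the defect of the j-th
    partial sum telescopes.  Combining them at neighbouring points gives structure
    relations expressing [h (n+1)] and [h (n-1)] separately through the values of [phi]
    at [y-1], [y], [y+1].  A suitable combination [twisted] of the shifts in [n], which
    does not depend on [s] or [x], then satisfies
    (q + 1/q) {2x+k+s} K f = (q^s + q^(-s)) f - twisted f, while on [h] it acts by the
    coefficients d_(-1), d_0, d_1.  As [twisted] is symmetric for the weight [w], moving it
    from [f] to [h] under the sum is the assertion; the boundary term of this summation
    by parts tends to 0 because Re v < 1 + s + t. *)

(** * Truncated Al-Salam--Chihara sums and their telescoping recurrences *)

(* For [phi_(u,s)(n,x)]: p = q^(-2), K = q^(-2k), X = q^(2n), Y = q^(2x) and
   W = q^(-2x-2s-2k); this is the 3phi2 of the Al-Salam--Chihara polynomials. *)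
Definition asc_term (p K X Y W : R) (j : nat) : R :=
  qpoch X p j * qpoch Y p j * qpoch W p j / (qpoch K p j * qpoch p p j) * p ^ j.

Definition asc_sum (p K X Y W : R) (N : nat) : R := sum_f_R0 (asc_term p K X Y W) N.

Lemma qpoch_S (a p : R) (n : nat) : qpoch a p (S n) = qpoch a p n * (1 - a * p ^ n).
Proof. reflexivity. Qed.

Lemma qpoch_shift (a p : R) (n : nat) : (1 - a) * qpoch (a * p) p n = qpoch a p (S n).
Proof.
  induction n as [|n IH]; [simpl; ring|].
  rewrite (qpoch_S a p (S n)), <- IH, qpoch_S. simpl. ring.
Qed.

Lemma qpoch_unshift (a p : R) (n : nat) : p <> 0 ->
  qpoch (a / p) p (S n) = (1 - a / p) * qpoch a p n.
Proof.
  intros Hp. rewrite <- qpoch_shift. now replace (a / p * p) with a by (field; auto).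
Qed.

(** The j-th terms of the two sides differ by a difference in j, whose sum up to [N] is the final
    product; the induction only has to verify one rational identity in p^N. *)
Lemma asc_sum_degree_partial (p K X Y W : R) (N : nat) : p <> 0 ->
  (forall j, qpoch K p j <> 0) -> (forall j, qpoch p p j <> 0) ->
  X * (Y + W) * asc_sum p K X Y W N
  = (X - K) * asc_sum p K (X / p) Y W N + (K + Y * W) * asc_sum p K X Y W N
    + Y * W * (X - 1) * asc_sum p K (X * p) Y W N
    - X * qpoch X p N * qpoch Y p (S N) * qpoch W p (S N) / (qpoch K p N * qpoch p p N).
Proof.
  intros Hp HK Hq. unfold asc_sum. induction N as [|N IH].
  - unfold asc_term; simpl. field.
  - rewrite !tech5.
    assert (H1 := HK (S N)). assert (H2 := Hq (S N)).
    assert (H3 := HK N). assert (H4 := Hq N).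
    (* The factor [X - 1] completes the shifted factorial to one of base [X]. Dividing by it instead
       would exclude X = 1, which is the case n = 0. *)
    assert (Hs : Y * W * (X - 1) * asc_term p K (X * p) Y W (S N)
      = - Y * W * (qpoch X p N * (1 - X * p ^ N) * (1 - X * p ^ S N)) * qpoch Y p (S N) * qpoch W p (S N)
        / (qpoch K p (S N) * qpoch p p (S N)) * p ^ S N).
    { rewrite <- !qpoch_S, <- qpoch_shift. unfold asc_term. field. auto. }
    rewrite (Rmult_plus_distr_l (X * (Y + W))), (Rmult_plus_distr_l (X - K)),
      (Rmult_plus_distr_l (K + Y * W)), (Rmult_plus_distr_l (Y * W * (X - 1))), Hs, IH. clear Hs IH.
    unfold asc_term. rewrite qpoch_unshift by auto. rewrite !qpoch_S in *.
    assert (H5 : 1 - K * p ^ N <> 0) by (intros E; apply H1; rewrite E; ring).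
    assert (H6 : 1 - p * p ^ N <> 0) by (intros E; apply H2; rewrite E; ring).
    simpl pow. field. auto.
Qed.

(** Again the defect telescopes. The terms are symmetric in [Y] and [W], and this exchange swaps
    [gm] and [g1]; in the variables of phi these are c_(-1) and c_1 divided by q^k. *)
Lemma asc_sum_spectral_partial (p K X Y W : R) (N : nat) : p <> 0 ->
  (forall j, qpoch K p j <> 0) -> (forall j, qpoch p p j <> 0) ->
  Y - W <> 0 -> Y - p * W <> 0 -> W - p * Y <> 0 ->
  let gm := W * (W - K) * (1 - Y) / ((W - Y) * (W - p * Y)) in
  let g1 := Y * (Y - K) * (1 - W) / ((Y - W) * (Y - p * W)) in
  X * asc_sum p K X Y W N
  = gm * asc_sum p K X (Y * p) (W / p) N + (1 - gm - g1) * asc_sum p K X Y W N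
    + g1 * asc_sum p K X (Y / p) (W * p) N
    - qpoch X p (S N) * qpoch Y p N * qpoch W p N / (qpoch K p N * qpoch p p N).
Proof.
  intros Hp HK Hq D0 D1 D2 gm g1. unfold asc_sum. induction N as [|N IH].
  - unfold asc_term; simpl. field.
  - rewrite !tech5.
    assert (H1 := HK (S N)). assert (H2 := Hq (S N)).
    assert (H3 := HK N). assert (H4 := Hq N).
    assert (D0' : W - Y <> 0) by lra.
    (* The factor 1 - Y of [gm] absorbs the shift of [Y], as 1 - W of [g1] absorbs that of [W]
       below; all terms then share the factorials (X;p)_(N+1), (Y;p)_N and (W;p)_N. *)
    assert (Hm : gm * asc_term p K X (Y * p) (W / p) (S N)
      = W * (W - K) / ((W - Y) * (W - p * Y)) * (1 - W / p) *
        (qpoch X p (S N) * (qpoch Y p N * (1 - Y * p ^ N) * (1 - Y * p ^ S N)) * qpoch W p N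
        / (qpoch K p (S N) * qpoch p p (S N)) * p ^ S N)).
    { rewrite <- (qpoch_S Y p N), <- (qpoch_S Y p (S N)), <- (qpoch_shift Y). unfold asc_term, gm.
      rewrite qpoch_unshift by auto. field. auto. }
    assert (Hg : g1 * asc_term p K X (Y / p) (W * p) (S N)
      = Y * (Y - K) / ((Y - W) * (Y - p * W)) * (1 - Y / p) *
        (qpoch X p (S N) * (qpoch W p N * (1 - W * p ^ N) * (1 - W * p ^ S N)) * qpoch Y p N
        / (qpoch K p (S N) * qpoch p p (S N)) * p ^ S N)).
    { rewrite <- (qpoch_S W p N), <- (qpoch_S W p (S N)), <- (qpoch_shift W). unfold asc_term, g1.
      rewrite qpoch_unshift by auto. field. auto. }
    rewrite (Rmult_plus_distr_l X), (Rmult_plus_distr_l gm),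
      (Rmult_plus_distr_l (1 - gm - g1)), (Rmult_plus_distr_l g1), Hm, Hg, IH. clear Hm Hg IH.
    unfold asc_term, gm, g1. rewrite !qpoch_S in *.
    assert (H5 : 1 - K * p ^ N <> 0) by (intros E; apply H1; rewrite E; ring).
    assert (H6 : 1 - p * p ^ N <> 0) by (intros E; apply H2; rewrite E; ring).
    simpl pow. field. repeat split; auto.
Qed.

(** The vanishing factorial removes the telescoped term. The sum at [X * p] stays grouped with its
    factor [X - 1], because for X = 1 it is not a value of phi. *)
Lemma asc_sum_degree_recurrence (p K X Y W : R) (N : nat) : p <> 0 ->
  (forall j, qpoch K p j <> 0) -> (forall j, qpoch p p j <> 0) -> qpoch X p N = 0 ->
  X * (Y + W) * asc_sum p K X Y W N
  = (X - K) * asc_sum p K (X / p) Y W N + (K + Y * W) * asc_sum p K X Y W N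
    + Y * W * ((X - 1) * asc_sum p K (X * p) Y W N).
Proof.
  intros Hp HK Hq HX.
  rewrite (asc_sum_degree_partial p K X Y W N Hp HK Hq), HX. unfold Rdiv. ring.
Qed.

Lemma asc_sum_spectral_recurrence (p K X Y W : R) (N : nat) : p <> 0 ->
  (forall j, qpoch K p j <> 0) -> (forall j, qpoch p p j <> 0) -> qpoch X p (S N) = 0 ->
  Y - W <> 0 -> Y - p * W <> 0 -> W - p * Y <> 0 ->
  let gm := W * (W - K) * (1 - Y) / ((W - Y) * (W - p * Y)) in
  let g1 := Y * (Y - K) * (1 - W) / ((Y - W) * (Y - p * W)) in
  X * asc_sum p K X Y W N
  = gm * asc_sum p K X (Y * p) (W / p) N + (1 - gm - g1) * asc_sum p K X Y W N
    + g1 * asc_sum p K X (Y / p) (W * p) N.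
Proof.
  intros Hp HK Hq HX D0 D1 D2 gm g1.
  rewrite (asc_sum_spectral_partial p K X Y W N Hp HK Hq D0 D1 D2), HX. unfold gm, g1, Rdiv. ring.
Qed.

(** * Zeros of q-shifted factorials and real powers of q *)

Lemma qpoch_neq_0 (a p : R) (n : nat) : (forall i, a * p ^ i <> 1) -> qpoch a p n <> 0.
Proof.
  intros H. induction n as [|n IH]; simpl; [lra|].
  apply Rmult_integral_contrapositive_currified; [auto|].
  intros E. apply (H n). lra.
Qed.

Lemma qpoch_eq_0 (a p : R) (i n : nat) : (i < n)%nat -> a * p ^ i = 1 -> qpoch a p n = 0.
Proof.
  intros Hi E. induction n as [|n IH]; [lia|].
  rewrite qpoch_S. destruct (Nat.eq_dec i n) as [<-|Hn].
  - rewrite E. ring.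
  - rewrite IH by lia. ring.
Qed.

Lemma Rpower_gt_1 (q a : R) : 0 < q < 1 -> a < 0 -> 1 < Rpower q a.
Proof.
  intros Hq Ha. rewrite <- (Ropp_involutive a), Rpower_Ropp, <- Rinv_1.
  apply Rinv_lt_contravar; [|apply Rpower_lt_1; lra].
  rewrite Rmult_1_r. apply exp_pos.
Qed.

Lemma Rpower_neq_0 (q a : R) : Rpower q a <> 0.
Proof. apply Rgt_not_eq, exp_pos. Qed.

Ltac rpow :=
  unfold Rdiv;
  repeat progress
    rewrite ?Rinv_mult, ?Rpower_pow_nat, <- ?Rpower_Ropp, <- ?Rpower_plus;
  try reflexivity;
  f_equal; rewrite ?S_INR; simpl; try field.

(** * Three-term recurrences of the real factor of phi *)

(** The factor of phi free of the complex parameter, so that both recurrences can be proved over the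
    reals. *)
Definition phi_sum (s k q : R) (n x : nat) : R :=
  sum_f_R0 (phi_term s k q n x) (Nat.min n x).

Lemma qpoch_p_neq_0 (q : R) (j : nat) : 0 < q < 1 ->
  qpoch (Rpower q (-2)) (Rpower q (-2)) j <> 0.
Proof.
  intros hq. apply qpoch_neq_0. intros i. rewrite Rpower_pow_nat, <- Rpower_plus.
  apply Rgt_not_eq, Rpower_gt_1; [auto|]. assert (H := pos_INR i). lra.
Qed.

Lemma qpoch_K_neq_0 (q k : R) (j : nat) : 0 < q < 1 -> 0 < k ->
  qpoch (Rpower q (- 2 * k)) (Rpower q (-2)) j <> 0.
Proof.
  intros hq hk. apply qpoch_neq_0. intros i. rewrite Rpower_pow_nat, <- Rpower_plus.
  apply Rgt_not_eq, Rpower_gt_1; [auto|]. assert (H := pos_INR i). lra.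
Qed.

Lemma qpoch_p_power_eq_0 (q : R) (n j : nat) : 0 < q < 1 -> (n < j)%nat ->
  qpoch (Rpower q (2 * INR n)) (Rpower q (-2)) j = 0.
Proof.
  intros hq Hj. apply (qpoch_eq_0 _ _ n); [auto|].
  rewrite Rpower_pow_nat, <- Rpower_plus, <- (Rpower_O q) by lra. f_equal. ring.
Qed.

(** Beyond min(n,x) one of the factorials of q^(2n) and q^(2x) vanishes, so any larger truncation
    gives the same sum. This lets neighbours in n or x, whose natural truncations differ, share one
    [N]. *)
Lemma phi_sum_asc_sum (q k s : R) (n x N : nat) : 0 < q < 1 -> (Nat.min n x <= N)%nat ->
  phi_sum s k q n x
  = asc_sum (Rpower q (-2)) (Rpower q (- 2 * k)) (Rpower q (2 * INR n)) (Rpower q (2 * INR x))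
      (Rpower q (- 2 * INR x - 2 * s - 2 * k)) N.
Proof.
  intros hq HN. unfold phi_sum, asc_sum.
  transitivity (sum_f_R0 (phi_term s k q n x) N).
  - induction HN as [|N HN IH]; [reflexivity|].
    rewrite tech5, <- IH. unfold phi_term.
    destruct (Nat.lt_ge_cases n (S N)) as [Hn|Hn].
    + rewrite (qpoch_p_power_eq_0 q n) by auto. unfold Rdiv. ring.
    + rewrite (qpoch_p_power_eq_0 q x) by (auto; lia). unfold Rdiv. ring.
  - apply sum_eq. intros j _. unfold phi_term, asc_term.
    f_equal. rpow.
Qed.

Lemma phi_sum_degree_recurrence (q k s : R) (n x : nat) : 0 < q < 1 -> 0 < k ->
  Rpower q (2 * INR n + k)
  * (Rpower q (2 * INR x + k + s) + / Rpower q (2 * INR x + k + s)) * phi_sum s k q n x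
  = Rpower q s * (Rpower q (2 * INR n + 2 * k) - 1) * phi_sum s k q (S n) x
    + (Rpower q s + / Rpower q s) * phi_sum s k q n x
    + / Rpower q s * (Rpower q (2 * INR n) - 1) * phi_sum s k q (pred n) x.
Proof.
  intros hq hk.
  set (p := Rpower q (-2)).
  set (K := Rpower q (- 2 * k)).
  set (X := Rpower q (2 * INR n)).
  set (Y := Rpower q (2 * INR x)).
  set (W := Rpower q (- 2 * INR x - 2 * s - 2 * k)).
  assert (HX : X <> 0) by apply Rpower_neq_0.
  assert (HY : Y <> 0) by apply Rpower_neq_0.
  assert (Hp : p <> 0) by apply Rpower_neq_0.
  assert (Ht : Rpower q s <> 0) by apply Rpower_neq_0.
  assert (Hkp : Rpower q k <> 0) by apply Rpower_neq_0.
  assert (EW : W = / (Y * Rpower q s ^ 2 * Rpower q k ^ 2)) by (unfold W, Y; rpow).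
  assert (EK : K = / Rpower q k ^ 2) by (unfold K; rpow).
  (* Truncation at n + 1 is long enough for the degrees n - 1, n and n + 1 at once. *)
  assert (H := asc_sum_degree_recurrence p K X Y W (S n) Hp
    (fun j => qpoch_K_neq_0 q k j hq hk) (fun j => qpoch_p_neq_0 q j hq)
    (qpoch_p_power_eq_0 q n (S n) hq (Nat.lt_succ_diag_r n))).
  assert (H0 : asc_sum p K X Y W (S n) = phi_sum s k q n x)
    by (symmetry; apply phi_sum_asc_sum; auto; lia).
  assert (H1 : asc_sum p K (X / p) Y W (S n) = phi_sum s k q (S n) x).
  { replace (X / p) with (Rpower q (2 * INR (S n))) by (unfold X, p; rpow).
    symmetry; apply phi_sum_asc_sum; auto; lia. }
  (* For n = 0 the shift would lead to degree -1, while [pred n] is 0; both sides vanish through X -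
     1 = 0. *)
  assert (H2 : (X - 1) * asc_sum p K (X * p) Y W (S n) = (X - 1) * phi_sum s k q (pred n) x).
  { destruct n as [|m].
    - replace X with 1; [ring|]. unfold X. rewrite Rmult_0_r, Rpower_O; lra.
    - f_equal. replace (X * p) with (Rpower q (2 * INR m)) by (unfold X, p; rpow).
      symmetry; apply phi_sum_asc_sum; simpl; auto; lia. }
  rewrite H0, H1, H2, EW, EK in H.
  replace (Rpower q (2 * INR n + k)) with (X * Rpower q k) by (unfold X; rpow).
  replace (Rpower q (2 * INR n + 2 * k)) with (X * Rpower q k ^ 2) by (unfold X; rpow).
  replace (Rpower q (2 * INR x + k + s)) with (Y * Rpower q k * Rpower q s) by (unfold Y; rpow).
  (* Since Y W = q^(-2s-2k), the sum Y + W is q^(-k-s) times l + 1/l with l = q^(2x+k+s).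
     Multiplying by q^(s+2k) therefore brings out the bracket on the left. *)
  apply (f_equal (Rmult (Rpower q s * Rpower q k ^ 2))) in H.
  match type of H with ?l = ?r =>
    transitivity l; [field; auto | rewrite H; field; auto] end.
Qed.

Lemma phi_sum_0 (t k q : R) (n : nat) : phi_sum t k q n 0 = 1.
Proof.
  unfold phi_sum. rewrite Nat.min_0_r. unfold phi_term; simpl.
  unfold Rpower. rewrite Rmult_0_r, Rmult_0_l, exp_0. field.
Qed.

Definition real_pred (f : nat -> R) (y : nat) : R :=
  match y with O => 0 | S y' => f y' end.

Lemma phi_sum_spectral_recurrence (q k t : R) (n y : nat) :
  0 < q < 1 -> 0 < k -> -1 < t ->
  Rpower q (2 * INR n + k) * phi_sum t k q n y
  = c_m1 y t k q * real_pred (phi_sum t k q n) y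
    + c_0 y t k q * phi_sum t k q n y + c_1 y t k q * phi_sum t k q n (S y).
Proof.
  intros hq hk ht.
  set (p := Rpower q (-2)).
  set (K := Rpower q (- 2 * k)).
  set (X := Rpower q (2 * INR n)).
  set (Y := Rpower q (2 * INR y)).
  set (W := Rpower q (- 2 * INR y - 2 * t - 2 * k)).
  assert (HX : X <> 0) by apply Rpower_neq_0.
  assert (HY : Y <> 0) by apply Rpower_neq_0.
  assert (Hp : p <> 0) by apply Rpower_neq_0.
  assert (HK : K <> 0) by apply Rpower_neq_0.
  assert (HW : W <> 0) by apply Rpower_neq_0.
  assert (Hkp : Rpower q k <> 0) by apply Rpower_neq_0.
  replace (Rpower q (2 * INR n + k)) with (Rpower q k * X) by (unfold X; rpow).
  unfold c_0. destruct y as [|y].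
  (* At y = 0 the generic denominators may vanish, for instance when t = -k. The neighbour y = 1 has
     only the terms j = 0 and j = 1, so the identity is computed directly. *)
  - simpl c_m1; simpl c_1; simpl real_pred. rewrite phi_sum_0.
    rewrite (phi_sum_asc_sum q k t n 1 1) by (auto; lia).
    unfold asc_sum, asc_term; simpl. fold p K X.
    rewrite !Rmult_1_r.
    replace (Rpower q 0) with 1 by (symmetry; apply Rpower_O; lra).
    replace (Rpower q 2) with (/ p) by (unfold p; rpow).
    replace (Rpower q (- 2 - 2 * t - 2 * k)) with (Rpower q (- 2 * t - 2 * k - 2)) by (f_equal; ring).
    fold K.
    assert (1 < Rpower q (- 2 * t - 2 * k - 2)) by (apply Rpower_gt_1; lra).
    assert (1 < K) by (apply Rpower_gt_1; lra).
    assert (1 < p) by (apply Rpower_gt_1; lra).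
    field. repeat split; lra.
  - set (Z := INR (S y)) in *.
    assert (HZ : 1 <= Z) by (unfold Z; rewrite S_INR; generalize (pos_INR y); lra).
    (* With Z >= 1, t > -1 and k > 0 all three exponents are negative; this makes the denominators
       of c_(-1) and c_1 nonzero. *)
    assert (Hlt : 1 < Rpower q (- 4 * Z - 2 * t - 2 * k + 2)) by (apply Rpower_gt_1; lra).
    assert (Hlt' : 1 < Rpower q (- 4 * Z - 2 * t - 2 * k)) by (apply Rpower_gt_1; lra).
    assert (Hlt'' : 1 < Rpower q (- 4 * Z - 2 * t - 2 * k - 2)) by (apply Rpower_gt_1; lra).
    assert (E1 : Rpower q (- 4 * Z - 2 * t - 2 * k) = W / Y) by (unfold W, Y; rpow).
    assert (E2 : Rpower q (- 4 * Z - 2 * t - 2 * k - 2) = W * p / Y) by (unfold W, Y, p; rpow).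
    assert (E3 : Rpower q (- 4 * Z - 2 * t - 2 * k + 2) = W / (Y * p)) by (unfold W, Y, p; rpow).
    rewrite E1 in Hlt'. rewrite E2 in Hlt''. rewrite E3 in Hlt.
    assert (D0 : Y - W <> 0).
    { intros E. replace W with Y in Hlt' by lra. replace (Y / Y) with 1 in Hlt' by (field; auto). lra. }
    assert (D1 : Y - p * W <> 0).
    { intros E. replace (W * p / Y) with 1 in Hlt''; [lra|]. replace Y with (p * W) by lra. field; auto. }
    assert (D2 : W - p * Y <> 0).
    { intros E. replace (W / (Y * p)) with 1 in Hlt; [lra|]. replace W with (p * Y) by lra. field; auto. }
    assert (H := asc_sum_spectral_recurrence p K X Y W (S n) Hp
      (fun j => qpoch_K_neq_0 q k j hq hk) (fun j => qpoch_p_neq_0 q j hq)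
      (qpoch_p_power_eq_0 q n (S (S n)) hq ltac:(lia)) D0 D1 D2).
    cbv zeta in H.
    assert (H0 : asc_sum p K X Y W (S n) = phi_sum t k q n (S y))
      by (symmetry; apply phi_sum_asc_sum; auto; lia).
    assert (H1 : asc_sum p K X (Y / p) (W * p) (S n) = phi_sum t k q n (S (S y))).
    { replace (Y / p) with (Rpower q (2 * INR (S (S y)))) by (unfold Y, Z, p; rpow).
      replace (W * p) with (Rpower q (- 2 * INR (S (S y)) - 2 * t - 2 * k)) by (unfold W, Z, p; rpow).
      symmetry; apply phi_sum_asc_sum; auto; lia. }
    assert (H2 : asc_sum p K X (Y * p) (W / p) (S n) = phi_sum t k q n y).
    { replace (Y * p) with (Rpower q (2 * INR y)) by (unfold Y, Z, p; rpow).
      replace (W / p) with (Rpower q (- 2 * INR y - 2 * t - 2 * k)) by (unfold W, Z, p; rpow).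
      symmetry; apply phi_sum_asc_sum; auto; lia. }
    rewrite H0, H1, H2 in H.
    rewrite Rmult_assoc, H.
    set (S0 := phi_sum t k q n (S y)). set (S1 := phi_sum t k q n (S (S y))).
    simpl real_pred. set (Sm := phi_sum t k q n y).
    (* In the variables [p], [K], [Y], [W] the two coefficients become q^k times those of the
       spectral recurrence for [asc_sum]. *)
    unfold c_m1, c_1. fold Z.
    rewrite E1, E2, E3.
    replace (Rpower q (- 4 * Z - 2 * t - 3 * k + 2)) with (Rpower q k * (W * K / (p * Y)))
      by (unfold W, Y, K, p; rpow).
    replace (Rpower q (- 2 * Z)) with (/ Y) by (unfold Y; rpow).
    replace (Rpower q (- 2 * Z - 2 * t)) with (W / K) by (unfold W, K; rpow).
    replace (Rpower q (- 2 * Z - 2 * k)) with (K / Y) by (unfold Y, K; rpow).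
    replace (Rpower q (- 2 * Z - 2 * t - 2 * k)) with W by reflexivity.
    assert (Y * p - W <> 0) by lra. assert (Y - W * p <> 0) by lra. assert (W - Y <> 0) by lra.
    assert (W - Y * p <> 0) by lra.
    assert (D3 : 1 - W / (Y * p) <> 0) by lra.
    field. repeat split; auto; lra.
Qed.

(** * Structure relations separating the two shifts in n *)

(** The degree recurrence gives the sum of the upward and downward terms. Because multiplication by
    q^(2n+k) picks up a factor q^2 or q^(-2) under a shift in n, combining it with the degree
    recurrences at the three neighbours in y gives a second, independent combination; the 2 by 2
    system is then solved. The factors [cm] and [X - 1] in the hypotheses allow for y = 0 and n = 0,
    where the missing neighbour has coefficient 0. *)
Lemma structure_relations (X kap tau lam qq c0 cm c1 : R) (Sm S0 S1 Smp S0p S1p Smm S0m S1m : R) :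
  X <> 0 -> kap <> 0 -> tau <> 0 -> lam <> 0 -> 0 < qq < 1 ->
  let mu := fun l => l + / l in
  let rec := fun l Sp S Sd => X * kap * mu l * S
    = tau * (X * kap ^ 2 - 1) * Sp + mu tau * S + / tau * (X - 1) * Sd in
  cm * (X * kap * mu (lam / qq) * Sm)
    = cm * (tau * (X * kap ^ 2 - 1) * Smp + mu tau * Sm + / tau * (X - 1) * Smm) ->
  rec lam S0p S0 S0m -> rec (lam * qq) S1p S1 S1m ->
  X * kap * S0 = cm * Sm + c0 * S0 + c1 * S1 ->
  X * qq * kap * S0p = cm * Smp + c0 * S0p + c1 * S1p ->
  (X - 1) * (X / qq * kap * S0m) = (X - 1) * (cm * Smm + c0 * S0m + c1 * S1m) ->
  tau * (X * kap ^ 2 - 1) * S0p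
    = lam * c1 * S1 + cm / lam * Sm + (c0 * mu lam - mu tau) / (qq + 1) * S0
  /\ / tau * (X - 1) * S0m
    = c1 / lam * S1 + lam * cm * Sm + (c0 * mu lam - mu tau) * qq / (qq + 1) * S0.
Proof.
  intros HX Hk Ht Hl Hq mu rec Am A0 A1 B0 Bp Bm. unfold rec in *. clear rec.
  set (U := tau * (X * kap ^ 2 - 1) * S0p) in *.
  set (Z := / tau * (X - 1) * S0m) in *.
  assert (I : mu lam * (cm * Sm + c0 * S0 + c1 * S1) = U + mu tau * S0 + Z).
  { rewrite <- B0, <- A0. ring. }
  (* Spectral recurrence applied to every term of the degree recurrence: the shifted terms acquire
     [qq] and [/ qq] relative to [I]. *)
  assert (II : cm * mu (lam / qq) * Sm + c0 * mu lam * S0 + c1 * mu (lam * qq) * S1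
     = qq * U + mu tau * S0 + Z / qq).
  { apply Rmult_eq_reg_l with (X * kap); [|apply Rmult_integral_contrapositive_currified; auto].
    transitivity (cm * (X * kap * mu (lam / qq) * Sm) + c0 * (X * kap * mu lam * S0)
      + c1 * (X * kap * mu (lam * qq) * S1)); [ring|].
    rewrite Am, A0, A1. unfold U, Z.
    transitivity (tau * (X * kap ^ 2 - 1) * (cm * Smp + c0 * S0p + c1 * S1p)
      + mu tau * (cm * Sm + c0 * S0 + c1 * S1)
      + / tau * ((X - 1) * (cm * Smm + c0 * S0m + c1 * S1m))); [ring|].
    rewrite <- B0, <- Bp, <- Bm. field. lra. }
  clearbody U Z. unfold mu in *.
  assert (D : qq + 1 <> 0) by lra. assert (D' : 1 - qq <> 0) by lra. assert (qq <> 0) by lra.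
  (* [qq] times [II] minus [I] eliminates [Z]; in [EZ], [qq] times [II] minus [qq ^ 2] times [I]
     eliminates [U]. *)
  assert (EU : U * (qq ^ 2 - 1) = qq * (cm * (lam / qq + / (lam / qq)) * Sm + c0 * (lam + / lam) * S0 + c1 * (lam * qq + / (lam * qq)) * S1 - (tau + / tau) * S0)
     - ((lam + / lam) * (cm * Sm + c0 * S0 + c1 * S1) - (tau + / tau) * S0)).
  { rewrite I, II. field. auto. }
  assert (EZ : Z * (1 - qq ^ 2) = qq * (cm * (lam / qq + / (lam / qq)) * Sm + c0 * (lam + / lam) * S0 + c1 * (lam * qq + / (lam * qq)) * S1 - (tau + / tau) * S0)
     - qq ^ 2 * ((lam + / lam) * (cm * Sm + c0 * S0 + c1 * S1) - (tau + / tau) * S0)).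
  { rewrite I, II. field. auto. }
  assert (D2 : qq ^ 2 - 1 <> 0) by nra.
  split.
  - apply Rmult_eq_reg_r with (qq ^ 2 - 1); [|auto]. rewrite EU. field. auto.
  - apply Rmult_eq_reg_r with (1 - qq ^ 2); [|lra]. rewrite EZ. field. auto.
Qed.

(** Here [qq] is q^2: a step in y multiplies [lam] by it, and a step in n multiplies q^(2n) by it.
    The quantity [del] is q + 1/q times d_0 with its factor {v} removed. *)
Lemma phi_sum_structure_relations (q k t : R) (n y : nat) : 0 < q < 1 -> 0 < k -> -1 < t ->
  let lam := Rpower q (2 * INR y + k + t) in
  let tau := Rpower q t in
  let del := c_0 y t k q * (lam + / lam) - (tau + / tau) in
  tau * (Rpower q (2 * INR n + 2 * k) - 1) * phi_sum t k q (S n) y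
  = lam * c_1 y t k q * phi_sum t k q n (S y)
    + c_m1 y t k q / lam * real_pred (phi_sum t k q n) y
    + del / (q ^ 2 + 1) * phi_sum t k q n y
  /\ / tau * (Rpower q (2 * INR n) - 1) * phi_sum t k q (pred n) y
  = c_1 y t k q / lam * phi_sum t k q n (S y)
    + lam * c_m1 y t k q * real_pred (phi_sum t k q n) y
    + del * q ^ 2 / (q ^ 2 + 1) * phi_sum t k q n y.
Proof.
  intros hq hk ht lam tau del.
  assert (Eq : q = Rpower q 1) by (symmetry; apply Rpower_1; lra).
  assert (EX : forall n, Rpower q (2 * INR n + k) = Rpower q (2 * INR n) * Rpower q k) by (intros; rpow).
  assert (EX2 : Rpower q (2 * INR n + 2 * k) = Rpower q (2 * INR n) * Rpower q k ^ 2) by rpow.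
  assert (Eq2 : q ^ 2 = Rpower q 2) by (rewrite Eq at 1; rpow).
  rewrite EX2.
  assert (HD := phi_sum_degree_recurrence q k t n).
  assert (HS := fun n => phi_sum_spectral_recurrence q k t n y hq hk ht).
  apply structure_relations with (Smp := real_pred (phi_sum t k q (S n)) y)
    (S1p := phi_sum t k q (S n) (S y)) (Smm := real_pred (phi_sum t k q (pred n)) y)
    (S1m := phi_sum t k q (pred n) (S y)) (kap := Rpower q k); try apply Rpower_neq_0; [nra|..].
  - destruct y as [|y]; [simpl; ring|]. f_equal. simpl real_pred.
    replace (lam / q ^ 2) with (Rpower q (2 * INR y + k + t)) by (rewrite Eq2; unfold lam; rpow).
    rewrite <- EX, HD by auto. rewrite EX2. reflexivity.
  - rewrite <- EX. unfold lam. rewrite HD by auto. rewrite EX2. reflexivity.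
  - replace (lam * q ^ 2) with (Rpower q (2 * INR (S y) + k + t)) by (rewrite Eq2; unfold lam; rpow).
    rewrite <- EX, HD by auto. rewrite EX2. reflexivity.
  - rewrite <- HS. f_equal. symmetry. apply EX.
  - rewrite <- HS. f_equal. rewrite Eq2. rpow.
  - destruct n as [|n].
    + rewrite Rmult_0_r, Rpower_O; [ring|lra].
    + f_equal. simpl pred. rewrite <- HS. f_equal. rewrite Eq2. rpow.
Qed.

(** * Complex powers of q *)

Lemma Cqpow_plus (q : R) (z1 z2 : C) : Cqpow q (z1 + z2) = (Cqpow q z1 * Cqpow q z2)%C.
Proof.
  unfold Cqpow, Cexp. destruct z1 as [a1 b1], z2 as [a2 b2].
  unfold Cmult, Cplus, RtoC; simpl.
  rewrite !Rmult_0_r, !Rplus_0_l, !Rminus_0_r, !Rmult_plus_distr_r.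
  rewrite exp_plus, cos_plus, sin_plus. f_equal; ring.
Qed.

Lemma Cqpow_RtoC (q r : R) : Cqpow q (RtoC r) = RtoC (Rpower q r).
Proof.
  unfold Cqpow, Cexp, RtoC, Rpower, Cmult; simpl.
  replace (r * 0 + 0 * ln q) with 0 by ring. rewrite cos_0, sin_0.
  replace (r * ln q - 0 * 0) with (r * ln q) by ring. f_equal; ring.
Qed.

Lemma Cqpow_neq_0 (q : R) (z : C) : Cqpow q z <> RtoC 0.
Proof.
  intros E. apply (f_equal Cmod) in E. unfold Cqpow in E.
  rewrite Cmod_Cexp, Cmod_0 in E. revert E. apply Rgt_not_eq, exp_pos.
Qed.

Lemma Cqpow_opp (q : R) (z : C) : Cqpow q (- z) = (/ Cqpow q z)%C.
Proof.
  assert (H : (Cqpow q (- z) * Cqpow q z = 1)%C).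
  { rewrite <- Cqpow_plus. replace (- z + z)%C with (RtoC 0) by ring.
    rewrite Cqpow_RtoC. f_equal. unfold Rpower. rewrite Rmult_0_l. apply exp_0. }
  rewrite <- (Cmult_1_r (Cqpow q (- z))), <- (Cinv_r (Cqpow q z)) by apply Cqpow_neq_0.
  rewrite Cmult_assoc, H. ring.
Qed.

Lemma qbrace_eq (q : R) (z : C) :
  qbrace q z = ((Cqpow q z + / Cqpow q z) / RtoC (q + / q))%C.
Proof. unfold qbrace. now rewrite Cqpow_opp. Qed.

(** * Action of the twisted operator on phi *)

(* The off-diagonal part of a twisted primitive element of U_q(su(1,1)); the junk value
   [f (pred 0)] is killed by its coefficient. *)
Definition twisted (k q : R) (f : nat -> C) (n : nat) : C :=
  (RtoC (Rpower q ((1 - k) / 2) * (1 - Rpower q (2 * INR n + 2 * k))) * f (S n)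
   + RtoC (Rpower q ((k - 1) / 2) * (1 - Rpower q (2 * INR n))) * f (pred n))%C.

(** A step in n multiplies the prefactor of phi by q^(s-u+k/2+1/2). Together with the coefficient
    q^((1-k)/2) this is q^s q^(1-u), so [u] survives only through q^(1-u) and its inverse. *)
Lemma twisted_phi (u : C) (s k q : R) (n x : nat) : 0 < q < 1 ->
  twisted k q (fun m => phi u s k q m x) n
  = (Cqpow q (RtoC (INR n) * (RtoC s - u + RtoC (k / 2) + RtoC (1 / 2)))
     * (RtoC q / Cqpow q u
          * RtoC (Rpower q s * (1 - Rpower q (2 * INR n + 2 * k)) * phi_sum s k q (S n) x)
        + Cqpow q u / RtoC q
          * RtoC (/ Rpower q s * (1 - Rpower q (2 * INR n)) * phi_sum s k q (pred n) x)))%C.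
Proof.
  intros hq. unfold twisted, phi. fold (phi_sum s k q (S n) x) (phi_sum s k q (pred n) x).
  set (g := (RtoC s - u + RtoC (k / 2) + RtoC (1 / 2))%C).
  assert (Hq : RtoC q <> 0) by (intros E; apply RtoC_inj in E; lra).
  assert (Hg : (RtoC (Rpower q ((1 - k) / 2)) * Cqpow q g
    = RtoC q * RtoC (Rpower q s) / Cqpow q u)%C).
  { unfold g. replace (RtoC s - u + RtoC (k / 2) + RtoC (1 / 2))%C
      with (- u + RtoC (s + k / 2 + 1 / 2))%C by (rewrite !RtoC_plus; ring).
    rewrite Cqpow_plus, Cqpow_opp, Cqpow_RtoC.
    replace (RtoC q * RtoC (Rpower q s))%C
      with (RtoC (Rpower q ((1 - k) / 2)) * RtoC (Rpower q (s + k / 2 + 1 / 2)))%C.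
    - unfold Cdiv. ring.
    - rewrite <- !RtoC_mult. f_equal. rewrite <- (Rpower_1 q) at 3 by lra.
      rewrite <- !Rpower_plus. f_equal. field. }
  assert (Hg' : (RtoC (Rpower q ((k - 1) / 2)) * / Cqpow q g
    = Cqpow q u / (RtoC q * RtoC (Rpower q s)))%C).
  { replace (Rpower q ((k - 1) / 2)) with (/ Rpower q ((1 - k) / 2))
      by (rewrite <- Rpower_Ropp; f_equal; field).
    assert (Hr : RtoC (Rpower q ((1 - k) / 2)) <> 0)
      by (intros E; apply RtoC_inj, Rpower_neq_0 in E; auto).
    assert (Hr' : RtoC (Rpower q s) <> 0)
      by (intros E; apply RtoC_inj, Rpower_neq_0 in E; auto).
    rewrite RtoC_inv by apply Rpower_neq_0.
    transitivity (/ (RtoC (Rpower q ((1 - k) / 2)) * Cqpow q g))%C.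
    - field. split; [apply Cqpow_neq_0 | auto].
    - rewrite Hg. field. repeat split; auto using Cqpow_neq_0. }
  assert (HS : forall m,
    Cqpow q (RtoC (INR (S m)) * g) = (Cqpow q (RtoC (INR m) * g) * Cqpow q g)%C).
  { intros m. rewrite <- Cqpow_plus. f_equal. rewrite S_INR, RtoC_plus. ring. }
  (* At n = 0 the prefactor at [pred n] is not the one at -1, but the coefficient 1 - q^(2n) is
     zero. *)
  assert (HP : (RtoC (1 - Rpower q (2 * INR n)) * Cqpow q (RtoC (INR (pred n)) * g)
     = RtoC (1 - Rpower q (2 * INR n)) * (Cqpow q (RtoC (INR n) * g) / Cqpow q g))%C).
  { destruct n as [|n].
    - rewrite Rmult_0_r, Rpower_O by lra. rewrite Rminus_diag. ring.
    - simpl pred. rewrite HS. field. apply Cqpow_neq_0. }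
  rewrite HS, !RtoC_mult.
  set (Gn := Cqpow q (RtoC (INR n) * g)) in *.
  set (Gp := Cqpow q (RtoC (INR (pred n)) * g)) in *.
  transitivity (Gn * ((RtoC (Rpower q ((1 - k) / 2)) * Cqpow q g)
      * RtoC (1 - Rpower q (2 * INR n + 2 * k)) * RtoC (phi_sum s k q (S n) x))
    + RtoC (Rpower q ((k - 1) / 2)) * (RtoC (1 - Rpower q (2 * INR n)) * Gp)
      * RtoC (phi_sum s k q (pred n) x))%C; [ring|].
  rewrite HP, Hg.
  transitivity (Gn * ((RtoC q * RtoC (Rpower q s) / Cqpow q u)
      * RtoC (1 - Rpower q (2 * INR n + 2 * k)) * RtoC (phi_sum s k q (S n) x)
    + (RtoC (Rpower q ((k - 1) / 2)) * / Cqpow q g) * RtoC (1 - Rpower q (2 * INR n))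
      * RtoC (phi_sum s k q (pred n) x)))%C; [unfold Cdiv; ring|].
  rewrite Hg', RtoC_inv by apply Rpower_neq_0.
  field. repeat split; auto using Cqpow_neq_0.
  intros E; apply RtoC_inj, Rpower_neq_0 in E; auto.
Qed.

(** For u = 1 the factors q^(1-u) and q^(u-1) are 1, and what remains is exactly the degree
    recurrence with its two shifted terms isolated. *)
Lemma twisted_phi_one (s k q : R) (n x : nat) : 0 < q < 1 -> 0 < k ->
  twisted k q (fun m => phi (RtoC 1) s k q m x) n
  = (RtoC (q + / q) * (qbrace q (RtoC s)
       - RtoC (Rpower q (2 * INR n + k)) * qbrace q (RtoC (2 * INR x + k + s)))
     * phi (RtoC 1) s k q n x)%C.
Proof.
  intros hq hk. rewrite twisted_phi by auto. unfold phi. fold (phi_sum s k q n x).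
  rewrite !qbrace_eq, !Cqpow_RtoC, Rpower_1 by lra.
  assert (Hq : RtoC q <> 0) by (intros E; apply RtoC_inj in E; lra).
  assert (HD : RtoC (q + / q) <> 0).
  { intros E; apply RtoC_inj in E. assert (0 < / q) by (apply Rinv_0_lt_compat; lra). lra. }
  assert (H := phi_sum_degree_recurrence q k s n x hq hk).
  rewrite <- !RtoC_inv by apply Rpower_neq_0.
  match goal with |- (?G * (_ * RtoC ?a + _ * RtoC ?b) = _)%C =>
    transitivity (G * RtoC (a + b))%C; [rewrite RtoC_plus; field; auto|] end.
  transitivity (Cqpow q (RtoC (INR n) * (RtoC s - RtoC 1 + RtoC (k / 2) + RtoC (1 / 2)))
    * RtoC ((Rpower q s + / Rpower q s - Rpower q (2 * INR n + k)
       * (Rpower q (2 * INR x + k + s) + / Rpower q (2 * INR x + k + s))) * phi_sum s k q n x))%C.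
  - do 2 f_equal. rewrite Rmult_minus_distr_r, H. ring.
  - rewrite !RtoC_mult, !RtoC_minus, !RtoC_mult, !RtoC_plus. rewrite !RtoC_plus in HD. field. exact HD.
Qed.

Lemma phi_spectral_recurrence (v : C) (t k q : R) (n y : nat) :
  0 < q < 1 -> 0 < k -> -1 < t ->
  (RtoC (Rpower q (2 * INR n + k)) * phi v t k q n y
   = RtoC (c_m1 y t k q) * at_pred (phi v t k q n) y
     + RtoC (c_0 y t k q) * phi v t k q n y + RtoC (c_1 y t k q) * phi v t k q n (S y))%C.
Proof.
  intros hq hk ht. assert (H := phi_sum_spectral_recurrence q k t n y hq hk ht).
  apply (f_equal RtoC) in H. rewrite !RtoC_plus, !RtoC_mult in H.
  set (G := Cqpow q (RtoC (INR n) * (RtoC t - v + RtoC (k / 2) + RtoC (1 / 2)))).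
  replace (at_pred (phi v t k q n) y) with (G * RtoC (real_pred (phi_sum t k q n) y))%C
    by (destruct y; [apply Cmult_0_r | reflexivity]).
  assert (E : forall y, phi v t k q n y = (G * RtoC (phi_sum t k q n y))%C) by reflexivity.
  rewrite !E, Cmult_comm, <- Cmult_assoc, (Cmult_comm (RtoC (phi_sum _ _ _ _ _))), H. ring.
Qed.

(** Weighting the structure relations by q^(1-v) and q^(v-1) pairs [lam] with [/ lam] into the
    brackets {2y+k+t-v+1} and {2y+k+t+v-1}. At y itself the weights 1 and q^2 of [del] combine to
    {v}. *)
Lemma twisted_phi_structure (v : C) (t k q : R) (n y : nat) : 0 < q < 1 -> 0 < k -> -1 < t ->
  twisted k q (fun m => phi v t k q m y) n
  = (- RtoC (q + / q) * (d_m1 y t v k q * at_pred (phi v t k q n) y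
       + d_0 y t v k q * phi v t k q n y + d_1 y t v k q * phi v t k q n (S y)))%C.
Proof.
  intros hq hk ht. rewrite twisted_phi by auto.
  destruct (phi_sum_structure_relations q k t n y hq hk ht) as [H1 H2].
  set (G := Cqpow q (RtoC (INR n) * (RtoC t - v + RtoC (k / 2) + RtoC (1 / 2)))).
  replace (at_pred (phi v t k q n) y) with (G * RtoC (real_pred (phi_sum t k q n) y))%C
    by (destruct y; [apply Cmult_0_r | reflexivity]).
  assert (E : forall y, phi v t k q n y = (G * RtoC (phi_sum t k q n y))%C) by reflexivity.
  rewrite !E. clear E.
  set (lam := Rpower q (2 * INR y + k + t)) in *.
  set (tau := Rpower q t) in *.
  set (a := Cqpow q v).
  assert (Ha : a <> 0) by apply Cqpow_neq_0.
  assert (Hl : lam <> 0) by apply Rpower_neq_0.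
  assert (Ht : tau <> 0) by apply Rpower_neq_0.
  assert (Hlc : RtoC lam <> 0) by (intros F; apply RtoC_inj in F; auto).
  assert (Htc : RtoC tau <> 0) by (intros F; apply RtoC_inj in F; auto).
  assert (Hq : RtoC q <> 0) by (intros F; apply RtoC_inj in F; lra).
  assert (HD : (RtoC q * RtoC q + 1 <> 0)%C).
  { rewrite <- RtoC_mult, <- RtoC_plus. intros F; apply RtoC_inj in F. nra. }
  assert (ED : RtoC (q + / q) = ((RtoC q * RtoC q + 1) / RtoC q)%C).
  { rewrite RtoC_plus, RtoC_inv by lra. field. auto. }
  assert (Em : Cqpow q (RtoC (2 * INR y + t + k) + v - RtoC 1) = (RtoC lam * a / RtoC q)%C).
  { unfold Cminus. rewrite !Cqpow_plus, Cqpow_opp, !Cqpow_RtoC, Rpower_1 by lra.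
    replace (2 * INR y + t + k) with (2 * INR y + k + t) by ring. reflexivity. }
  assert (E1 : Cqpow q (RtoC (2 * INR y + k + t) - v + RtoC 1) = (RtoC lam / a * RtoC q)%C).
  { unfold Cminus. rewrite !Cqpow_plus, Cqpow_opp, !Cqpow_RtoC, Rpower_1 by lra. reflexivity. }
  replace (tau * (1 - Rpower q (2 * INR n + 2 * k)) * phi_sum t k q (S n) y)
    with (- (tau * (Rpower q (2 * INR n + 2 * k) - 1) * phi_sum t k q (S n) y)) by ring.
  replace (/ tau * (1 - Rpower q (2 * INR n)) * phi_sum t k q (pred n) y)
    with (- (/ tau * (Rpower q (2 * INR n) - 1) * phi_sum t k q (pred n) y)) by ring.
  rewrite H1, H2. clear H1 H2.
  unfold d_m1, d_0, d_1. rewrite !qbrace_eq, Em, E1, !Cqpow_RtoC, ED.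
  fold lam tau a.
  set (c0 := c_0 y t k q). set (c1 := c_1 y t k q). set (cm := c_m1 y t k q).
  set (S0 := phi_sum t k q n y). set (S1 := phi_sum t k q n (S y)).
  set (Sm := real_pred (phi_sum t k q n) y).
  assert (Hd : q ^ 2 + 1 <> 0) by nra.
  unfold Rdiv.
  rewrite !RtoC_opp, !RtoC_plus, !RtoC_mult, !RtoC_minus, !RtoC_mult, !RtoC_plus, !RtoC_inv by auto.
  rewrite !RtoC_plus.
  replace (RtoC (q ^ 2)) with (RtoC q * RtoC q)%C by (rewrite <- RtoC_mult; f_equal; ring).
  field. auto.
Qed.

(** * Absolutely convergent complex series *)

Lemma ex_series_Re_Im (a : nat -> C) : ex_series (fun n => Cmod (a n)) ->
  ex_series (fun n => Re (a n)) /\ ex_series (fun n => Im (a n)).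
Proof.
  intros H. split;
    apply (ex_series_le (K := R_AbsRing) (V := R_CompleteNormedModule)) with (2 := H);
    intros n; unfold norm; simpl; unfold abs; simpl.
  - apply re_le_Cmod.
  - apply Rle_trans with (2 := Rmax_Cmod (a n)), Rmax_r.
Qed.

Lemma ex_series_Cmod_plus (a b : nat -> C) :
  ex_series (fun n => Cmod (a n)) -> ex_series (fun n => Cmod (b n)) ->
  ex_series (fun n => Cmod (a n + b n)%C).
Proof.
  intros Ha Hb.
  apply (ex_series_le (K := R_AbsRing) (V := R_CompleteNormedModule))
    with (fun n => Cmod (a n) + Cmod (b n)).
  - intros n; unfold norm; simpl; unfold abs; simpl.
    rewrite Rabs_pos_eq by apply Cmod_ge_0. apply Cmod_triangle.
  - now apply (ex_series_plus (V := R_NormedModule)).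
Qed.

Lemma ex_series_Cmod_scal (c : C) (a : nat -> C) :
  ex_series (fun n => Cmod (a n)) -> ex_series (fun n => Cmod (c * a n)%C).
Proof.
  intros Ha. apply ex_series_ext with (fun n => Cmod c * Cmod (a n)).
  - intros n. now rewrite Cmod_mult.
  - now apply (ex_series_scal (V := R_NormedModule)).
Qed.

Lemma CSeries_ext (a b : nat -> C) : (forall n, a n = b n) -> CSeries a = CSeries b.
Proof. intros H. unfold CSeries. f_equal; apply Series_ext; intros n; now rewrite H. Qed.

Lemma CSeries_plus (a b : nat -> C) :
  ex_series (fun n => Cmod (a n)) -> ex_series (fun n => Cmod (b n)) ->
  CSeries (fun n => a n + b n)%C = (CSeries a + CSeries b)%C.
Proof.
  intros Ha Hb. apply ex_series_Re_Im in Ha, Hb. destruct Ha, Hb.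
  unfold CSeries, Cplus; simpl. f_equal; rewrite <- Series_plus by auto; reflexivity.
Qed.

Lemma CSeries_scal (c : C) (a : nat -> C) :
  ex_series (fun n => Cmod (a n)) -> CSeries (fun n => c * a n)%C = (c * CSeries a)%C.
Proof.
  intros Ha. apply ex_series_Re_Im in Ha. destruct Ha as [Hr Hi].
  unfold CSeries, Cmult; simpl. f_equal.
  - rewrite <- !Series_scal_l, <- Series_minus; [reflexivity| |];
      now apply (ex_series_scal (V := R_NormedModule)).
  - rewrite <- !Series_scal_l, <- Series_plus; [reflexivity| |];
      now apply (ex_series_scal (V := R_NormedModule)).
Qed.

(** The hypotheses make [V] the sequence of partial sums. Real and imaginary parts are treated
    together as a subtractive [g] dominated by the modulus. *)
Lemma CSeries_telescope (a V : nat -> C) :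
  a O = V O -> (forall n, a (S n) = V (S n) - V n)%C ->
  is_lim_seq (fun n => Cmod (V n)) 0 -> CSeries a = RtoC 0.
Proof.
  intros H0 HS HV.
  assert (Hlim : forall g : C -> R, (forall z, Rabs (g z) <= Cmod z) ->
    (forall z1 z2, g (z1 - z2)%C = g z1 - g z2) -> Series (fun n => g (a n)) = 0).
  { intros g Hg Hsub. apply is_series_unique.
    change (is_lim_seq (sum_n (fun n => g (a n))) 0).
    apply is_lim_seq_ext with (fun n => g (V n)).
    - induction n as [|n IH]; [now rewrite sum_O, H0|].
      rewrite sum_Sn, <- IH, HS, Hsub. unfold plus; simpl. ring.
    - apply is_lim_seq_abs_0.
      apply is_lim_seq_le_le with (fun _ => 0) (fun n => Cmod (V n));
        [|apply is_lim_seq_const|exact HV].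
      intros n. split; [apply Rabs_pos|apply Hg]. }
  unfold CSeries, RtoC. f_equal; apply Hlim.
  - intros z. apply re_le_Cmod.
  - reflexivity.
  - intros z. apply Rle_trans with (2 := Rmax_Cmod z), Rmax_r.
  - reflexivity.
Qed.

(** * Growth bounds and summation by parts in n *)

Lemma Cmod_phi_le (u : C) (s k q : R) (x : nat) : 0 < q < 1 ->
  exists M, 0 <= M /\
    forall n, Cmod (phi u s k q n x) <= M * Rpower q (s - Re u + k / 2 + 1 / 2) ^ n.
Proof.
  intros hq. destruct (phi_sum_bounded s k q x hq) as [M [HM H]].
  exists M. split; [auto|]. intros n. unfold phi, Cqpow.
  rewrite Cmod_mult, Cmod_Cexp, Cmod_R, Rpower_pow_nat, Rmult_comm.
  match goal with |- _ * ?a <= _ * ?b => replace a with b end.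
  - apply Rmult_le_compat_r; [apply Rlt_le, exp_pos | apply H].
  - unfold Rpower. f_equal. destruct u; simpl. ring.
Qed.

(** Detailed balance between neighbouring points: this is what makes [twisted] symmetric with
    respect to the weight. *)
Lemma w_S (k q : R) (n : nat) : 0 < q < 1 ->
  w k q (S n) * (Rpower q ((k - 1) / 2) * (1 - Rpower q (2 * INR (S n))))
  = w k q n * (Rpower q ((1 - k) / 2) * (1 - Rpower q (2 * INR n + 2 * k))).
Proof.
  intros hq. unfold w. rewrite !qpoch_S.
  assert (Eq2 : forall m, (q ^ 2) ^ m = Rpower q (2 * INR m)).
  { intros m. rewrite <- (Rpower_1 q) at 1 by lra. rpow. }
  replace (Rpower q (2 * k) * (q ^ 2) ^ n) with (Rpower q (2 * INR n + 2 * k))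
    by (rewrite Eq2; rpow).
  replace (q ^ 2 * (q ^ 2) ^ n) with (Rpower q (2 * INR (S n)))
    by (rewrite <- Eq2; reflexivity).
  replace (Rpower q (- INR (S n) * (k - 1)))
    with (Rpower q (- INR n * (k - 1)) * Rpower q ((1 - k) / 2) / Rpower q ((k - 1) / 2)) by rpow.
  assert (H1 : forall m, 1 - Rpower q (2 * INR (S m)) <> 0).
  { intros m. assert (Rpower q (2 * INR (S m)) < 1); [|lra].
    apply Rpower_lt_1; [auto|]. generalize (lt_0_INR (S m) (Nat.lt_0_succ m)). lra. }
  assert (H2 : qpoch (q ^ 2) (q ^ 2) n <> 0).
  { apply qpoch_neq_0. intros i. specialize (H1 i). rewrite <- Eq2 in H1. simpl in *. lra. }
  field. auto using Rpower_neq_0.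
Qed.

Lemma w_bounds (k q : R) (n : nat) : 0 < q < 1 -> 0 < k ->
  0 <= w k q n <= Rpower q (1 - k) ^ n / qpoch (q ^ 2) (q ^ 2) n.
Proof.
  intros hq hk.
  assert (Hq2 : forall i, 0 < (q ^ 2) ^ i <= 1).
  { intros i. assert (0 < q ^ 2 <= 1) by nra.
    split; [apply pow_lt; lra|]. rewrite <- (pow1 i); apply pow_incr; lra. }
  assert (HD : 0 < qpoch (q ^ 2) (q ^ 2) n)
    by (apply qpoch_pos; intros i _; specialize (Hq2 i); nra).
  assert (HN : 0 <= qpoch (Rpower q (2 * k)) (q ^ 2) n <= 1).
  { apply qpoch_bounds; intros i _. specialize (Hq2 i).
    assert (0 < Rpower q (2 * k)) by apply exp_pos.
    assert (Rpower q (2 * k) < 1) by (apply Rpower_lt_1; lra). nra. }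
  apply Rinv_0_lt_compat in HD.
  unfold w, Rdiv. rewrite Rpower_pow_nat.
  replace ((1 - k) * INR n) with (- INR n * (k - 1)) by ring.
  assert (HE : 0 < Rpower q (- INR n * (k - 1))) by apply exp_pos.
  assert (0 <= Rpower q (- INR n * (k - 1)) * qpoch (Rpower q (2 * k)) (q ^ 2) n
    <= Rpower q (- INR n * (k - 1))) by nra.
  split; [apply Rmult_le_pos; lra | apply Rmult_le_compat_r; lra].
Qed.

(** The weighted Casoratian of [f] and [h], the discrete analogue of the Wronskian in Green's
    formula. *)
Definition boundary (k q : R) (f h : nat -> C) (n : nat) : C :=
  (RtoC (w k q n * (Rpower q ((1 - k) / 2) * (1 - Rpower q (2 * INR n + 2 * k))))
   * (f n * h (S n) - h n * f (S n)))%C.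

Lemma twisted_symmetric_0 (k q : R) (f h : nat -> C) : 0 < q ->
  (RtoC (w k q 0) * (f O * twisted k q h O - h O * twisted k q f O))%C = boundary k q f h 0.
Proof.
  intros hq. unfold boundary, twisted. simpl pred. simpl (INR 0).
  replace (1 - Rpower q (2 * 0)) with 0 by (rewrite Rmult_0_r, Rpower_O; lra).
  rewrite !Rmult_0_r, !RtoC_mult. ring.
Qed.

(** The upward shifts form the boundary term at n + 1; by detailed balance the downward shifts form
    the one at n. *)
Lemma twisted_symmetric_S (k q : R) (f h : nat -> C) (n : nat) : 0 < q < 1 ->
  (RtoC (w k q (S n)) * (f (S n) * twisted k q h (S n) - h (S n) * twisted k q f (S n)))%C
  = (boundary k q f h (S n) - boundary k q f h n)%C.
Proof.
  intros hq. unfold boundary at 2. rewrite <- w_S by auto.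
  unfold boundary, twisted. simpl pred. rewrite !RtoC_mult. ring.
Qed.

(** The growth rates of the weight and of the two functions multiply to q^(1+s+t-Re v), which is
    below 1. The boundary term is thus dominated by a multiple of the general term of a convergent
    series. *)
Lemma boundary_phi_lim (x y : nat) (s t : R) (v : C) (k q : R) :
  0 < q < 1 -> 0 < k -> Re v < 1 + s + t ->
  is_lim_seq (fun n => Cmod (boundary k q (fun m => phi (RtoC 1) s k q m x)
                                          (fun m => phi v t k q m y) n)) 0.
Proof.
  intros hq hk hv.
  destruct (Cmod_phi_le (RtoC 1) s k q x hq) as [M1 [HM1 H1]].
  destruct (Cmod_phi_le v t k q y hq) as [M2 [HM2 H2]].
  set (r1 := Rpower q (s - Re (RtoC 1) + k / 2 + 1 / 2)) in *.
  set (r2 := Rpower q (t - Re v + k / 2 + 1 / 2)) in *.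
  set (r := Rpower q ((1 - k) / 2)).
  set (e := Rpower q (1 + s + t - Re v)).
  assert (Hr1 : 0 < r1) by apply exp_pos.
  assert (Hr2 : 0 < r2) by apply exp_pos.
  assert (Hr : 0 < r) by apply exp_pos.
  assert (He : 0 < e < 1) by (split; [apply exp_pos | apply Rpower_lt_1; lra]).
  assert (Ee : Rpower q (1 - k) * (r1 * r2) = e).
  { unfold r1, r2, e. rewrite <- !Rpower_plus. f_equal. simpl. field. }
  assert (Hs : ex_series (fun n => e ^ n / qpoch (q ^ 2) (q ^ 2) n))
    by (apply ex_series_geom_qpoch; nra).
  apply ex_series_lim_0 in Hs.
  apply (is_lim_seq_scal_l _ (r * (M1 * M2 * (r1 + r2)))) in Hs.
  rewrite Rbar_mult_0_r in Hs.
  apply is_lim_seq_le_le with (2 := is_lim_seq_const 0) (3 := Hs).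
  intros n. split; [apply Cmod_ge_0|].
  unfold boundary. rewrite Cmod_mult, Cmod_R.
  destruct (w_bounds k q n hq hk) as [W0 W1].
  set (f := fun m => phi (RtoC 1) s k q m x) in *. set (h := fun m => phi v t k q m y) in *.
  (* In each of the two products exactly one factor is taken at n + 1, which costs [r2] or [r1]. *)
  assert (HB : Cmod (f n * h (S n) - h n * f (S n)) <= M1 * M2 * (r1 + r2) * (r1 * r2) ^ n).
  { unfold Cminus. eapply Rle_trans; [apply Cmod_triangle|].
    rewrite Cmod_opp, !Cmod_mult.
    assert (A1 := H1 n). assert (A2 := H1 (S n)). assert (B1 := H2 n). assert (B2 := H2 (S n)).
    fold (f n) in A1. fold (f (S n)) in A2. fold (h n) in B1. fold (h (S n)) in B2.
    rewrite Rpow_mult_distr.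
    replace (M1 * M2 * (r1 + r2) * (r1 ^ n * r2 ^ n))
      with (M1 * r1 ^ n * (M2 * r2 ^ S n) + M2 * r2 ^ n * (M1 * r1 ^ S n)) by (simpl; ring).
    apply Rplus_le_compat; apply Rmult_le_compat; auto using Cmod_ge_0. }
  assert (HX : 0 <= 1 - Rpower q (2 * INR n + 2 * k) <= 1).
  { assert (0 < Rpower q (2 * INR n + 2 * k)) by apply exp_pos.
    assert (Rpower q (2 * INR n + 2 * k) < 1); [|lra].
    apply Rpower_lt_1; [auto|]. generalize (pos_INR n). lra. }
  fold r. rewrite Rabs_pos_eq by (apply Rmult_le_pos; [auto|apply Rmult_le_pos; lra]).
  apply Rle_trans with ((Rpower q (1 - k) ^ n / qpoch (q ^ 2) (q ^ 2) n * r)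
    * (M1 * M2 * (r1 + r2) * (r1 * r2) ^ n)).
  - apply Rmult_le_compat; [|apply Cmod_ge_0| |exact HB].
    + apply Rmult_le_pos; [auto|apply Rmult_le_pos; lra].
    + apply Rmult_le_compat; [auto|apply Rmult_le_pos; lra|auto|]. nra.
  - rewrite <- Ee, !Rpow_mult_distr. right. unfold Rdiv. ring.
Qed.

(** * The recurrence for the sum *)

(** The spectral recurrence turns the c-combination of [h] into q^(2n+k) h, and q^(2n+k) b is then
    traded for [twisted] acting on [f]; the d-combination is [twisted] acting on [h]. Clearing the
    denominator [D] leaves the antisymmetric expression. *)
Lemma Pr_summand_identity (q k s t : R) (x y : nat) (v : C) (n : nat) :
  0 < q < 1 -> 0 < k -> -1 < t ->
  let D := RtoC (q + / q) in
  let b := qbrace q (RtoC (2 * INR x + k + s)) in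
  let f := fun m => phi (RtoC 1) s k q m x in
  let h := fun m => phi v t k q m y in
  (D * (b * RtoC (c_m1 y t k q) - d_m1 y t v k q)
     * at_pred (fun y' => Pr_term x y' s t v k q n) y
   + D * (b * RtoC (c_0 y t k q) - (d_0 y t v k q + qbrace q (RtoC s)))
     * Pr_term x y s t v k q n
   + D * (b * RtoC (c_1 y t k q) - d_1 y t v k q) * Pr_term x (S y) s t v k q n
   = RtoC (w k q n) * (f n * twisted k q h n - h n * twisted k q f n))%C.
Proof.
  intros hq hk ht D b f h. unfold f at 2, h at 1.
  rewrite twisted_phi_one, twisted_phi_structure by auto. fold D b.
  assert (H := phi_spectral_recurrence v t k q n y hq hk ht).
  replace (at_pred (fun y' => Pr_term x y' s t v k q n) y)
    with (f n * at_pred (phi v t k q n) y * RtoC (w k q n))%C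
    by (destruct y; [simpl; ring | reflexivity]).
  unfold Pr_term. fold (f n) (h n).
  transitivity (RtoC (w k q n) * f n * D *
    (b * (RtoC (c_m1 y t k q) * at_pred (phi v t k q n) y
     + RtoC (c_0 y t k q) * phi v t k q n y + RtoC (c_1 y t k q) * phi v t k q n (S y))
     - (d_m1 y t v k q * at_pred (phi v t k q n) y
     + d_0 y t v k q * phi v t k q n y + d_1 y t v k q * phi v t k q n (S y))
     - qbrace q (RtoC s) * phi v t k q n y))%C; [unfold h; ring|].
  rewrite <- H. unfold h, f. ring.
Qed.

Theorem proposition4p6 (q k s t : R) (x y : nat) (v : C)
    (hq0 : 0 < q) (hq1 : q < 1) (hk : 0 < k) (hs : -1 < s) (ht : -1 < t)
    (hv : Re v < 1 + s + t) :
  let P := fun y' : nat => Pr x y' s t v k q in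
  (qbrace q (RtoC (2 * INR x + k + s))
   * (RtoC (c_m1 y t k q) * at_pred P y
      + RtoC (c_0 y t k q) * P y
      + RtoC (c_1 y t k q) * P (S y))
   = d_m1 y t v k q * at_pred P y
     + (d_0 y t v k q + qbrace q (RtoC s)) * P y
     + d_1 y t v k q * P (S y))%C.
Proof.
  intros P. assert (hq : 0 < q < 1) by lra.
  set (T := fun n y' => Pr_term x y' s t v k q n).
  assert (Hex : forall y', ex_series (fun n => Cmod (T n y')))
    by (intros y'; exact (Pr_abs_convergent x y' s t v k q hq hk hv)).
  assert (Hexm : ex_series (fun n => Cmod (at_pred (T n) y))).
  (* At y = 0 the omitted term is handled as the zero multiple of a convergent series. *)
  { destruct y as [|y]; [|apply Hex].
    apply ex_series_ext with (fun n => Cmod (RtoC 0 * T n O)%C).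
    - intros n. now rewrite Cmult_0_l.
    - now apply ex_series_Cmod_scal. }
  assert (Em : at_pred P y = CSeries (fun n => at_pred (T n) y)).
  { destruct y as [|y]; [|reflexivity]. simpl.
    rewrite (CSeries_ext _ (fun n => RtoC 0 * T n O)%C), CSeries_scal by (auto; intros; ring).
    ring. }
  set (b := qbrace q (RtoC (2 * INR x + k + s))).
  set (D := RtoC (q + / q)).
  assert (HD : D <> 0).
  { intros E; apply RtoC_inj in E. assert (0 < / q) by (apply Rinv_0_lt_compat; lra). lra. }
  set (am := (D * (b * RtoC (c_m1 y t k q) - d_m1 y t v k q))%C).
  set (a0 := (D * (b * RtoC (c_0 y t k q) - (d_0 y t v k q + qbrace q (RtoC s))))%C).
  set (a1 := (D * (b * RtoC (c_1 y t k q) - d_1 y t v k q))%C).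
  (* [D] times the difference of the two sides is the sum of the summand identities, whose partial
     sums are the boundary terms. *)
  assert (H : (am * at_pred P y + a0 * P y + a1 * P (S y) = 0)%C).
  { rewrite Em. unfold P, Pr. change (Pr_term x ?y' s t v k q) with (fun n => T n y').
    rewrite <- !CSeries_scal, <- !CSeries_plus
      by auto using ex_series_Cmod_plus, ex_series_Cmod_scal.
    apply CSeries_telescope with (3 := boundary_phi_lim x y s t v k q hq hk hv); cbv beta.
    - rewrite <- twisted_symmetric_0 by auto. now apply Pr_summand_identity.
    - intros n. rewrite <- twisted_symmetric_S by auto. now apply Pr_summand_identity. }
  set (L := (b * _)%C). set (Q := (_ + _ + _)%C).
  assert (H' : (D * (L - Q) = 0)%C) by (rewrite <- H; unfold L, Q, am, a0, a1; ring).
  assert (H'' : (L - Q = 0)%C).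
  { transitivity (/ D * (D * (L - Q)))%C; [field; auto|]. rewrite H'. ring. }
  transitivity (L - Q + Q)%C; [ring|]. rewrite H''. ring.
Qed.
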